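(* Let $n_s\ge 2$ and let $\mathbf u_L,\mathbf u_R$ be admissible left and right states of the one-dimensional Riemann problem for the multi-species Euler equations. For $Z\in\{L,R\}$ set $A_Z=\frac{2}{(\gamma_Z+1)\rho_Z}$, $B_Z=\frac{\gamma_Z-1}{\gamma_Z+1}p_Z$, $c_Z=\sqrt{\gamma_Zp_Z/\rho_Z}$, and for $p\ge 0$ $$f_Z(p)=\begin{cases}(p-p_Z)\sqrt{\dfrac{A_Z}{p+B_Z}}, & p>p_Z,\\[2mm] \dfrac{2c_Z}{\gamma_Z-1}\Big(\big(\tfrac{p}{p_Z}\big)^{\frac{\gamma_Z-1}{2\gamma_Z}}-1\Big), & p\le p_Z,\end{cases}\qquad \varphi(p)=f_L(p)+f_R(p)+v_R-v_L .$$ Assume $p^*$ is a solution of $\varphi(p)=0$. Then the maximum wave speed in the Riemann problem is $$\lambda_{\max}(\mathbf u_L,\mathbf u_R)=\max\big(|\lambda_L(p^* )|,|\lambda_R(p^* )|\big),$$ where $$\lambda_L(p^* )=v_L-c_L\sqrt{1+\tfrac{\gamma_L+1}{2\gamma_L}\max\Big(\tfrac{p^*-p_L}{p_L},0\Big)},\qquad \lambda_R(p^* )=v_R+c_R\sqrt{1+\tfrac{\gamma_R+1}{2\gamma_R}\max\Big(\tfrac{p^*-p_R}{p_R},0\Big)} .$$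
   Context: Each species $k\in\{1,\dots,n_s\}$ has constant specific heats $c_{p,k}>c_{v,k}>0$, so $\gamma_k=c_{p,k}/c_{v,k}>1$. The state (projected onto a unit direction $\mathbf n$) is $\mathbf u=(\alpha_1\rho_1,\dots,\alpha_{n_s}\rho_{n_s},m,E)^{\mathsf T}$, where $\alpha_k\rho_k$ is a single conserved variable (partial density), $m$ the momentum and $E$ the total energy. Set $\rho=\sum_k\alpha_k\rho_k$, $v=m/\rho$, $e=E/\rho-v^2/2$, $Y_k=\alpha_k\rho_k/\rho$, $\mathbf Y=(Y_1,\dots,Y_{n_s})$, $c_p(\mathbf Y)=\sum_kY_kc_{p,k}$, $c_v(\mathbf Y)=\sum_kY_kc_{v,k}$, $\gamma(\mathbf Y)=c_p(\mathbf Y)/c_v(\mathbf Y)$, and $p=(\gamma(\mathbf Y)-1)\rho e$. The Riemann problem is $$\partial_t(\alpha_k\rho_k)+\partial_x(v\,\alpha_k\rho_k)=0\ (1\le k\le n_s),\quad \partial_t m+\partial_x(vm+p)=0,\quad \partial_tE+\partial_x(v(E+p))=0,$$ with initial data $\mathbf u_L$ for $x<0$ and $\mathbf u_R$ for $x>0$. Admissible states satisfy $\alpha_k\rho_k\ge0$ for all $k$, $\rho>0$, and $e>0$ (the further requirement that the mixture specific entropy be at least the essential infimum of that of the initial data is automatic for the Riemann data). For $Z\in\{L,R\}$, $\rho_Z,v_Z,p_Z$ and $\gamma_Z=\gamma(\mathbf Y_Z)$ are evaluated at $\mathbf u_Z$. The self-similar entropy solution of the Riemann problem consists of a left wave (1-wave,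 a shock or an expansion), a contact discontinuity, and a right wave ($(n_s+2)$-wave, a shock or an expansion), associated respectively with the eigenvalues $v-c$, $v$ (multiplicity $n_s$), $v+c$, where $c=\sqrt{\gamma p/\rho}$. The maximum wave speed is the largest absolute value of the speeds of these waves: the speed of a shock is its propagation speed, the speeds of an expansion are all characteristic speeds in the fan, and a left (right) wave of zero strength is assigned the characteristic speed $v_L-c_L$ ($v_R+c_R$). *)

(* Defs.v *)
From HB Require Import structures.
From mathcomp Require Import all_boot all_order all_algebra.
From mathcomp Require Import all_classical all_reals all_analysis.
Set Implicit Arguments.
Unset Strict Implicit.
Unset Printing Implicit Defensive.
Import Order.TTheory GRing.Theory Num.Theory.
Import numFieldNormedType.Exports.
Local Open Scope classical_set_scope.
Local Open Scope ring_scope.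

(* A state is u = (alpha_1 rho_1, ..., alpha_n rho_n, m, E).  The arguments
   cp, cv are the specific heats of the n species. *)
Definition pdens (R : realType) (n : nat) (u : 'rV[R]_(n + 2)) (k : 'I_n) : R :=
  u 0 (lshift 2 k).

Definition momentum (R : realType) (n : nat) (u : 'rV[R]_(n + 2)) : R :=
  u 0 (rshift n (0 : 'I_2)).

Definition energy (R : realType) (n : nat) (u : 'rV[R]_(n + 2)) : R :=
  u 0 (rshift n (1 : 'I_2)).

Definition density (R : realType) (n : nat) (u : 'rV[R]_(n + 2)) : R :=
  \sum_(k < n) pdens u k.

Definition velocity (R : realType) (n : nat) (u : 'rV[R]_(n + 2)) : R :=
  momentum u / density u.

Definition internal_energy (R : realType) (n : nat) (u : 'rV[R]_(n + 2)) : R :=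
  energy u / density u - velocity u ^+ 2 / 2.

Definition mass_frac (R : realType) (n : nat) (u : 'rV[R]_(n + 2)) (k : 'I_n) : R :=
  pdens u k / density u.

Definition mix_heat (R : realType) (n : nat) (h : 'I_n -> R)
    (u : 'rV[R]_(n + 2)) : R :=
  \sum_(k < n) mass_frac u k * h k.

Definition gamma (R : realType) (n : nat) (cp cv : 'I_n -> R)
    (u : 'rV[R]_(n + 2)) : R :=
  mix_heat cp u / mix_heat cv u.

Definition pressure (R : realType) (n : nat) (cp cv : 'I_n -> R)
    (u : 'rV[R]_(n + 2)) : R :=
  (gamma cp cv u - 1) * density u * internal_energy u.

Definition sound_speed (R : realType) (n : nat) (cp cv : 'I_n -> R)
    (u : 'rV[R]_(n + 2)) : R :=
  Num.sqrt (gamma cp cv u * pressure cp cv u / density u).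

Definition admissible (R : realType) (n : nat) (u : 'rV[R]_(n + 2)) : Prop :=
  [/\ forall k, 0 <= pdens u k, 0 < density u & 0 < internal_energy u].

Definition flux (R : realType) (n : nat) (cp cv : 'I_n -> R)
    (u : 'rV[R]_(n + 2)) : 'rV[R]_(n + 2) :=
  row_mx (\row_(k < n) (velocity u * pdens u k))
         (\row_(j < 2) if j == 0
            then velocity u * momentum u + pressure cp cv u
            else velocity u * (energy u + pressure cp cv u)).

Definition eig_left (R : realType) (n : nat) (cp cv : 'I_n -> R)
    (u : 'rV[R]_(n + 2)) : R := velocity u - sound_speed cp cv u.

Definition eig_right (R : realType) (n : nat) (cp cv : 'I_n -> R)
    (u : 'rV[R]_(n + 2)) : R := velocity u + sound_speed cp cv u.

Definition rankine_hugoniot (R : realType) (n : nat) (cp cv : 'I_n -> R) (s : R)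
    (um up : 'rV[R]_(n + 2)) : Prop :=
  flux cp cv up - flux cp cv um = s *: (up - um).

(* (x, t) |-> U (x / t) satisfies d_t u + d_x (flux u) = 0 on the ray
   x / t = xi:  (flux o U)'(xi) = xi * U'(xi), component by component. *)
Definition self_similar_at (R : realType) (n : nat) (cp cv : 'I_n -> R)
    (U : R -> 'rV[R]_(n + 2)) (xi : R) : Prop :=
  forall i : 'I_(n + 2), exists d : R,
    is_derive xi (1 : R) (fun z => U z 0 i) d /\
    is_derive xi (1 : R) (fun z => flux cp cv (U z) 0 i) (xi * d).

Variant wave_kind := Shock | Expansion | ZeroStrength.

(* A wave of the genuinely nonlinear family with eigenvalue lam, joining um
   (on its left) to up (on its right) and filling the sector a <= x / t <= b.
   Entropy-admissible shocks are those satisfying Lax's inequalities. *)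
Definition is_wave (R : realType) (n : nat) (cp cv : 'I_n -> R)
    (lam : 'rV[R]_(n + 2) -> R) (U : R -> 'rV[R]_(n + 2))
    (w : wave_kind) (a b : R) (um up : 'rV[R]_(n + 2)) : Prop :=
  match w with
  | Shock => [/\ a = b, rankine_hugoniot cp cv a um up & lam up < a < lam um]
  | Expansion =>
      [/\ a < b, U xi @[xi --> a^'+] --> um, U xi @[xi --> b^'-] --> up
        & forall xi, a < xi < b ->
            [/\ admissible (U xi), lam (U xi) = xi & self_similar_at cp cv U xi]]
  | ZeroStrength => [/\ a = b, um = up & a = lam um]
  end.

(* The speeds of an expansion are the characteristic speeds in the closed fan. *)
Definition wave_speeds (R : realType) (n : nat)
    (lam : 'rV[R]_(n + 2) -> R) (U : R -> 'rV[R]_(n + 2))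
    (w : wave_kind) (a b : R) (um : 'rV[R]_(n + 2)) : set R :=
  match w with
  | Shock => [set a]
  | Expansion => closure [set lam (U xi) | xi in `]a, b[]
  | ZeroStrength => [set lam um]
  end.

Definition is_contact (R : realType) (n : nat) (cp cv : 'I_n -> R) (sigma : R)
    (um up : 'rV[R]_(n + 2)) : Prop :=
  [/\ velocity um = sigma, velocity up = sigma & rankine_hugoniot cp cv sigma um up].

(* The self-similar function U (x / t) with its wave pattern: the left wave
   fills [aL, bL], the contact is at sigma, the right wave fills [aR, bR]. *)
Record riemann_pattern (R : realType) (n : nat) := RiemannPattern {
  profile : R -> 'rV[R]_(n + 2);
  kindL : wave_kind;
  aL : R;
  bL : R;
  starL : 'rV[R]_(n + 2);
  sigma : R;
  starR : 'rV[R]_(n + 2);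
  kindR : wave_kind;
  aR : R;
  bR : R }.

(* The second alternative for the middle wave is the limit case where both
   expansions reach the vacuum exactly on the ray x / t = sigma, so that there
   are no intermediate constant states (it corresponds to the root p = 0 of
   phi below). *)
Definition riemann_solution (R : realType) (n : nat) (cp cv : 'I_n -> R)
    (uL uR : 'rV[R]_(n + 2)) (W : riemann_pattern R n) : Prop :=
  [/\ [/\ aL W <= bL W, bL W <= sigma W, sigma W <= aR W & aR W <= bR W],
      [/\ forall xi, xi < aL W -> profile W xi = uL,
          forall xi, bL W < xi < sigma W -> profile W xi = starL W,
          forall xi, sigma W < xi < aR W -> profile W xi = starR W
        & forall xi, bR W < xi -> profile W xi = uR],
      is_wave cp cv (eig_left cp cv) (profile W) (kindL W) (aL W) (bL W)
        uL (starL W),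
      is_wave cp cv (eig_right cp cv) (profile W) (kindR W) (aR W) (bR W)
        (starR W) uR
    & [/\ admissible (starL W), admissible (starR W)
        & is_contact cp cv (sigma W) (starL W) (starR W)]
      \/ [/\ starL W = 0, starR W = 0, bL W = sigma W & sigma W = aR W]].

Definition all_wave_speeds (R : realType) (n : nat) (cp cv : 'I_n -> R)
    (uL : 'rV[R]_(n + 2)) (W : riemann_pattern R n) : set R :=
  wave_speeds (eig_left cp cv) (profile W) (kindL W) (aL W) (bL W) uL
  `|` [set sigma W]
  `|` wave_speeds (eig_right cp cv) (profile W) (kindR W) (aR W) (bR W) (starR W).

Definition is_max_wave_speed (R : realType) (n : nat) (cp cv : 'I_n -> R)
    (uL : 'rV[R]_(n + 2)) (W : riemann_pattern R n) (M : R) : Prop :=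
  (exists2 s, all_wave_speeds cp cv uL W s & `|s| = M) /\
  (forall s, all_wave_speeds cp cv uL W s -> `|s| <= M).

Definition f_wave (R : realType) (n : nat) (cp cv : 'I_n -> R)
    (uZ : 'rV[R]_(n + 2)) (p : R) : R :=
  let g := gamma cp cv uZ in
  let pZ := pressure cp cv uZ in
  let A := 2 / ((g + 1) * density uZ) in
  let B := (g - 1) / (g + 1) * pZ in
  let c := Num.sqrt (g * pZ / density uZ) in
  if p > pZ then (p - pZ) * Num.sqrt (A / (p + B))
  else 2 * c / (g - 1) * ((p / pZ) `^ ((g - 1) / (2 * g)) - 1).

Definition phi (R : realType) (n : nat) (cp cv : 'I_n -> R)
    (uL uR : 'rV[R]_(n + 2)) (p : R) : R :=
  f_wave cp cv uL p + f_wave cp cv uR p + velocity uR - velocity uL.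

Definition speed_factor (R : realType) (n : nat) (cp cv : 'I_n -> R)
    (uZ : 'rV[R]_(n + 2)) (p : R) : R :=
  let g := gamma cp cv uZ in
  let pZ := pressure cp cv uZ in
  Num.sqrt (1 + (g + 1) / (2 * g) * Num.max ((p - pZ) / pZ) 0).

Definition lambdaL (R : realType) (n : nat) (cp cv : 'I_n -> R)
    (uL : 'rV[R]_(n + 2)) (p : R) : R :=
  velocity uL - sound_speed cp cv uL * speed_factor cp cv uL p.

Definition lambdaR (R : realType) (n : nat) (cp cv : 'I_n -> R)
    (uR : 'rV[R]_(n + 2)) (p : R) : R :=
  velocity uR + sound_speed cp cv uR * speed_factor cp cv uR p.

(* Main.v *)
Require Import Defs.
From mathcomp Require Import all_boot all_order all_algebra.
From mathcomp Require Import all_classical all_reals all_analysis.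
From mathcomp Require Import ring lra.
Set Implicit Arguments.
Unset Strict Implicit.
Unset Printing Implicit Defensive.
Import Order.TTheory GRing.Theory Num.Theory.
Import numFieldNormedType.Exports.
Local Open Scope classical_set_scope.
Local Open Scope ring_scope.

(** Every wave of the solution lives between its two edges, and the waves are
    ordered from left to right, so all speeds lie between the leading edge [aL]
    of the left wave and the leading edge [bR] of the right wave, and both
    edges are themselves speeds. The maximum is therefore
    [max |aL| |bR|], and it remains to see that [aL] and [bR] are
    [lambdaL] and [lambdaR] at the given root of [phi].

    A left wave from the gas [um] to an admissible state [up] satisfies, with
    [p] the pressure of [up], both [aL = lambdaL um p] and
    [velocity up = velocity um - f_wave um p] ([left_wave]).
    - For a shock ([left_shock]) this is the Hugoniot computation in the frame
      of the front; Lax's inequalities select the compressive branch.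
    - For an expansion the smooth equations along the fan, together with
      [velocity - sound speed = x / t], determine all derivatives
      ([fan_derivatives], [fan_velocity_derivative]): the composition is
      constant, the velocity is affine in [x / t], and the entropy is constant
      ([fan_mass_frac], [fan_velocity], [fan_isentropic]). These integrals are
      evaluated at the head and continued to the tail
      ([fan_tail_isentropic]). The head moves at the characteristic speed of
      [um], and the pressure falls, so the maximum in [lambdaL] vanishes.
    - If the fan ends in the vacuum, the same limits hold with [p = 0], and the
      velocity of the contact is the speed of the tail.

    Right waves are reflected left waves ([is_wave_mirror], [right_wave]).
    Velocity and pressure agree on both sides of the contact, and subtracting
    the two velocity relations shows that the pressure at the contact is a root
    of [phi]. Since both wave curves increase strictly ([f_wave_lt]), the root
    is unique, hence it is the given one. *)

(** * Admissible states *)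

Section States.
Context (R : realType) (n : nat) (cp cv : 'I_n -> R).
Implicit Types (u um up : 'rV[R]_(n + 2)) (s : R).

Lemma flux_pdens u k : flux cp cv u 0 (lshift 2 k) = velocity u * pdens u k.
Proof. by rewrite /flux row_mxEl mxE. Qed.

Lemma flux_momentum u :
  flux cp cv u 0 (rshift n (0 : 'I_2)) =
  velocity u * momentum u + pressure cp cv u.
Proof. by rewrite /flux row_mxEr mxE. Qed.

Lemma flux_energy u :
  flux cp cv u 0 (rshift n (1 : 'I_2)) =
  velocity u * (energy u + pressure cp cv u).
Proof. by rewrite /flux row_mxEr mxE. Qed.

Lemma density0 : density (0 : 'rV[R]_(n + 2)) = 0.
Proof. by rewrite /density big1 // => k _; rewrite /pdens mxE. Qed.

(** With the convention on division by zero the pressure of the vacuum is also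
    the limit of the pressure in a fan that ends there, so the two kinds of
    tail can be treated together. *)
Lemma pressure0 : pressure cp cv 0 = 0.
Proof. by rewrite /pressure density0 mulr0 mul0r. Qed.

Lemma momentumE u : density u != 0 -> momentum u = density u * velocity u.
Proof. by move=> r0; rewrite /velocity mulrC divfK. Qed.

Lemma mass_frac_sum u : density u != 0 -> \sum_k mass_frac u k = 1.
Proof. by move=> r0; rewrite /mass_frac -mulr_suml divff. Qed.

Lemma gamma_mass_frac um up :
  (forall k, mass_frac um k = mass_frac up k) ->
  gamma cp cv um = gamma cp cv up.
Proof.
move=> hY; rewrite /gamma /mix_heat.
by congr (_ / _); apply: eq_bigr => k _; rewrite hY.
Qed.

Lemma energyE u : density u != 0 -> gamma cp cv u != 1 ->
  energy u = pressure cp cv u / (gamma cp cv u - 1)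
             + density u * velocity u ^+ 2 / 2.
Proof.
move=> r0 g1; rewrite /pressure /internal_energy.
by field; rewrite r0 subr_eq0 g1.
Qed.

Lemma rankine_hugoniotE s um up : rankine_hugoniot cp cv s um up ->
  [/\ forall k, (velocity up - s) * pdens up k = (velocity um - s) * pdens um k,
      (velocity up - s) * momentum up + pressure cp cv up =
        (velocity um - s) * momentum um + pressure cp cv um
    & (velocity up - s) * energy up + velocity up * pressure cp cv up =
        (velocity um - s) * energy um + velocity um * pressure cp cv um].
Proof.
have subE (A B : 'rV[R]_(n + 2)) j : (A - B) 0 j = A 0 j - B 0 j.
  by rewrite !mxE.
move=> h; have {}h j : flux cp cv up 0 j - flux cp cv um 0 j =
    s * (up 0 j - um 0 j).
  by rewrite -!subE h [LHS]mxE.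
split => [k||].
- by have := h (lshift 2 k); rewrite !flux_pdens /pdens; lra.
- by have := h (rshift n (0 : 'I_2)); rewrite !flux_momentum /momentum; lra.
- by have := h (rshift n (1 : 'I_2)); rewrite !flux_energy /energy; lra.
Qed.

Lemma rankine_hugoniot_mass s um up : rankine_hugoniot cp cv s um up ->
  (velocity up - s) * density up = (velocity um - s) * density um.
Proof.
by case/rankine_hugoniotE => h _ _; rewrite !mulr_sumr; apply: eq_bigr.
Qed.

End States.

Section AdmissibleStates.
Context (R : realType) (n : nat) (cp cv : 'I_n -> R).
Hypothesis hc : forall k : 'I_n, 0 < cv k < cp k.
Implicit Types (u um up : 'rV[R]_(n + 2)) (s : R).

Lemma density_gt0 u : admissible u -> 0 < density u.
Proof. by case. Qed.

Lemma density_neq0 u : admissible u -> density u != 0.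
Proof. by move=> /density_gt0/gt_eqF ->. Qed.

Lemma gamma_gt1 u : admissible u -> 1 < gamma cp cv u.
Proof.
move=> [pk0 r0 _]; have rn0 : density u != 0 by rewrite gt_eqF.
have Y0 k : 0 <= mass_frac u k by rewrite divr_ge0 // ltW.
have [k Yk] : exists k, 0 < mass_frac u k.
  apply/existsP; apply: contraT; rewrite negb_exists => /forallP h.
  have := mass_frac_sum rn0; rewrite big1 => [/esym/eqP|k _].
    by rewrite oner_eq0.
  by apply/eqP; rewrite eq_le Y0 andbT leNgt.
(* some species is present, so averages with the weights [mass_frac u] preserve
   strict positivity *)
have pos (h : 'I_n -> R) : (forall k, 0 < h k) -> 0 < mix_heat h u.
  move=> h0; rewrite /mix_heat (bigD1 k) //= ltr_wpDr //; last exact: mulr_gt0.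
  by rewrite sumr_ge0 // => i _; rewrite mulr_ge0 // ltW.
rewrite /gamma ltr_pdivlMr; last by apply: pos => i; case/andP: (hc i).
rewrite mul1r -subr_gt0 -sumrB.
under eq_bigr do rewrite -mulrBr.
apply: (pos (fun i => cp i - cv i)) => i.
by rewrite subr_gt0; case/andP: (hc i).
Qed.

Lemma pressure_gt0 u : admissible u -> 0 < pressure cp cv u.
Proof.
move=> hu; case: (hu) => _ r0 e0.
by rewrite /pressure !mulr_gt0 // subr_gt0 gamma_gt1.
Qed.

Lemma sound_speed_arg_gt0 u : admissible u ->
  0 < gamma cp cv u * pressure cp cv u / density u.
Proof.
move=> hu; rewrite divr_gt0 ?density_gt0 // mulr_gt0 ?pressure_gt0 //.
by apply: lt_trans (gamma_gt1 hu).
Qed.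

Lemma sound_speed_gt0 u : admissible u -> 0 < sound_speed cp cv u.
Proof. by move=> hu; rewrite sqrtr_gt0 sound_speed_arg_gt0. Qed.

Lemma sound_speed_sqr u : admissible u ->
  sound_speed cp cv u ^+ 2 = gamma cp cv u * pressure cp cv u / density u.
Proof. by move=> hu; rewrite sqr_sqrtr // ltW // sound_speed_arg_gt0. Qed.

(** * The wave curves in the pressure *)

(** For a compressed gas it is simplest to compare squares:
    with [x = p - pZ] and [K = pZ + B] the square of [f_wave] is
    [A x ^ 2 / (x + K)], which increases with [x]. *)
Lemma f_wave_lt u (p q : R) : admissible u -> 0 <= p -> p < q ->
  f_wave cp cv u p < f_wave cp cv u q.
Proof.
move=> hu p0 pq; have g1 := gamma_gt1 hu; have P0 := pressure_gt0 hu.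
have r0 := density_gt0 hu; rewrite /f_wave.
set g := gamma cp cv u in g1 *; set P := pressure cp cv u in P0 *.
set B := (g - 1) / (g + 1) * P; set A := 2 / _.
have A0 : 0 < A by rewrite divr_gt0 // mulr_gt0 //; lra.
have B0 : 0 < B by rewrite mulr_gt0 // divr_gt0 //; lra.
clearbody A B.
have fpos x : P < x -> 0 < (x - P) * Num.sqrt (A / (x + B)).
  by move=> Px; rewrite mulr_gt0 ?subr_gt0 // sqrtr_gt0 divr_gt0 //; lra.
set k := _ * Num.sqrt _ / _.
have k0 : 0 < k.
  rewrite divr_gt0 ?subr_gt0 // mulr_gt0 //.
  exact: sound_speed_gt0 hu.
set ex := (g - 1) / (2 * g).
have ex0 : 0 < ex by rewrite divr_gt0 //; lra.
have fle x : 0 <= x -> x <= P -> k * ((x / P) `^ ex - 1) <= 0.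
  move=> x0 xP; rewrite mulr_ge0_le0 ?(ltW k0) // subr_le0.
  have <- : 1 `^ ex = 1 :> R by rewrite powR1.
  apply: ge0_ler_powR; first exact: ltW ex0.
  - by rewrite nnegrE divr_ge0 // ltW.
  - by rewrite nnegrE.
  - by rewrite ler_pdivrMr // mul1r.
case: (ltP P p) => [Pp|pP].
  have Pq : P < q := lt_trans Pp pq; rewrite Pq.
  have pB : 0 < p + B by rewrite addr_gt0 // (lt_trans P0).
  have qB : 0 < q + B by rewrite addr_gt0 // (lt_trans P0).
  rewrite -(ltr_pXn2r (n := 2)) ?nnegrE ?ltW ?fpos // !exprMn.
  rewrite !sqr_sqrtr ?divr_ge0 ?ltW //.
  rewrite !(mulrA (_ ^+ 2)) ltr_pdivrMr // [ltRHS]mulrAC ltr_pdivlMr //.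
  have -> : (p - P) ^+ 2 * A * (q + B) =
    (q - P) ^+ 2 * A * (p + B) - A * (q - p) * ((p - P) * (q - P)
       + (P + B) * ((q - P) + (p - P))) by ring.
  rewrite ltrBlDr ltrDl.
  have [pP0 qP0 qp0] : [/\ 0 < p - P, 0 < q - P & 0 < q - p].
    by rewrite !subr_gt0.
  apply: mulr_gt0; first exact: mulr_gt0.
  apply: addr_gt0; first exact: mulr_gt0.
  by apply: mulr_gt0; apply: addr_gt0.
case: (ltP P q) => [Pq|qP].
  by apply: le_lt_trans (fle _ p0 pP) (fpos _ Pq).
rewrite ltr_pM2l // ltrD2r; apply: gt0_ltr_powR; rewrite ?nnegrE //.
- by rewrite divr_ge0 // ltW.
- by rewrite divr_ge0 ?ltW // (le_lt_trans p0).
- by rewrite ltr_pM2r ?invr_gt0.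
Qed.

(** * Shocks *)

(** Here [w] is the gas velocity relative to the shock. Eliminating the density
    and the pressure behind the shock leaves a quadratic equation in [w1] with
    the trivial root [w0]; Lax's inequalities exclude this root. *)
Lemma shock_relations (g r0 r1 w0 w1 p0 p1 : R) :
  1 < g -> 0 < r0 -> 0 < r1 -> 0 < p0 -> 0 < w0 ->
  r1 * w1 = r0 * w0 ->
  p1 + r1 * w1 ^+ 2 = p0 + r0 * w0 ^+ 2 ->
  g / (g - 1) * (p1 / r1) + w1 ^+ 2 / 2 =
    g / (g - 1) * (p0 / r0) + w0 ^+ 2 / 2 ->
  g * p0 / r0 < w0 ^+ 2 -> w1 ^+ 2 < g * p1 / r1 ->
  p0 < p1 /\ w0 ^+ 2 = (g + 1) / (2 * r0) * (p1 + (g - 1) / (g + 1) * p0).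
Proof.
move=> g1 r0_gt0 r1_gt0 p0_gt0 w0_gt0 mass mom ener sup sub.
have g10 : g - 1 != 0 by lra.
have gp10 : g + 1 != 0 by lra.
have r0n : r0 != 0 by rewrite gt_eqF.
have r1n : r1 != 0 by rewrite gt_eqF.
have w0n : w0 != 0 by rewrite gt_eqF.
have w1_gt0 : 0 < w1 by rewrite -(pmulr_rgt0 _ r1_gt0) mass mulr_gt0.
have w1n : w1 != 0 by rewrite gt_eqF.
have r1E : r1 = r0 * w0 / w1 by rewrite -mass mulfK.
have p1E : p1 = p0 + r0 * w0 * (w0 - w1).
  move: mom; rewrite r1E => mom.
  by apply: (addIr (r0 * w0 / w1 * w1 ^+ 2)); rewrite mom; field.
(* for [w1 = w0] the two sides of the front would be the same gas, which cannot
   move at once faster and slower than sound *)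
have w10 : w1 != w0.
  apply/eqP => w10; move: sub; rewrite r1E p1E w10 subrr mulr0 addr0 mulfK //.
  by lra.
have quad : (g + 1) * (w0 * w1) = (g - 1) * w0 ^+ 2 + 2 * (g * p0 / r0).
  apply: (mulfI (x := w0 - w1)); first by rewrite subr_eq0 eq_sym.
  have e : g / (g - 1) * (p1 / r1) - g / (g - 1) * (p0 / r0)
           - (w0 ^+ 2 - w1 ^+ 2) / 2 = 0 by lra.
  move: e; rewrite p1E r1E => e.
  apply/eqP; rewrite -subr_eq0; apply/eqP.
  rewrite -[RHS](mulr0 (2 * (g - 1) * w0)) -e.
  by field; rewrite r0n g10 w1n w0n.
have w1_lt : w1 < w0.
  rewrite -(ltr_pM2l w0_gt0) -(ltr_pM2l (x := g + 1)); last lra.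
  by rewrite quad -[w0 * w0]expr2; lra.
split; first by rewrite p1E ltrDl !mulr_gt0 // subr_gt0.
rewrite p1E; apply: (mulfI (x := 2)); first by rewrite pnatr_eq0.
have -> : 2 * w0 ^+ 2 = (g + 1) * w0 ^+ 2 - (g + 1) * (w0 * w1)
  + 2 * (g * p0 / r0) by rewrite quad; ring.
by field; rewrite r0n gp10.
Qed.

(** The mass balance makes the mass flux through the front common to both
    sides, so the mass fractions, and with them [gamma], do not jump. *)
Lemma shock_gamma s um up : admissible um -> admissible up ->
  rankine_hugoniot cp cv s um up -> s < velocity um ->
  gamma cp cv up = gamma cp cv um.
Proof.
move=> hm hp RH svm; apply: gamma_mass_frac => k.
have rm := density_neq0 hm; have rp := density_neq0 hp.
have [mk _ _] := rankine_hugoniotE RH; have m := rankine_hugoniot_mass RH.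
have w0 : velocity um - s != 0 by rewrite subr_eq0 gt_eqF.
apply/eqP; rewrite /mass_frac eqr_div //; apply/eqP; apply: (mulfI w0).
by rewrite mulrCA -m [RHS]mulrA -mk; ring.
Qed.

Lemma left_shock s um up : admissible um -> admissible up ->
  rankine_hugoniot cp cv s um up ->
  eig_left cp cv up < s < eig_left cp cv um ->
  s = lambdaL cp cv um (pressure cp cv up) /\
  velocity up = velocity um - f_wave cp cv um (pressure cp cv up).
Proof.
move=> hm hp RH; rewrite /eig_left => /andP[lax_p lax_m].
have cm := sound_speed_gt0 hm; have cp0 := sound_speed_gt0 hp.
have svm : s < velocity um by lra.
have g_eq := shock_gamma hm hp RH svm.
have g1 := gamma_gt1 hm; have r0 := density_gt0 hm; have r1 := density_gt0 hp.
have p0 := pressure_gt0 hm; have p1 := pressure_gt0 hp.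
have cm2 := sound_speed_sqr hm; have cp2 := sound_speed_sqr hp.
have [_ mom ener] := rankine_hugoniotE RH; have mass := rankine_hugoniot_mass RH.
have r0n := density_neq0 hm; have r1n := density_neq0 hp.
have gp1 : gamma cp cv up != 1 by rewrite g_eq gt_eqF.
have gm1 : gamma cp cv um != 1 by rewrite gt_eqF.
move: mom ener; rewrite !momentumE ?(energyE r0n gm1) ?(energyE r1n gp1) // g_eq.
rewrite g_eq in cp2.
rewrite /lambdaL /speed_factor /f_wave.
rewrite -/(sound_speed cp cv um).
(* from here on only the scalar balance laws matter *)
move: (gamma cp cv um) g1 {gp1 gm1 g_eq} cm2 cp2 => g g1 cm2 cp2.
move: (pressure cp cv um) (pressure cp cv up) p0 p1 cm2 cp2 =>
  P0 P1 p0 p1 cm2 cp2.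
move: (density um) (density up) r0 r1 r0n r1n mass cm2 cp2 =>
  r0 r1 r0_gt0 r1_gt0 r0n r1n mass cm2 cp2.
move: (sound_speed cp cv um) (sound_speed cp cv up) cm cp0 cm2 cp2 lax_p lax_m =>
  c0 c1 c0_gt0 c1_gt0 c02 c12 lax_p lax_m.
move: (velocity um) (velocity up) mass lax_p lax_m svm =>
  v0 v1 mass lax_p lax_m svm mom ener.
have w0 : 0 < v0 - s by lra.
have w0n : v0 - s != 0 by rewrite gt_eqF.
have w1 : 0 < v1 - s by rewrite -(pmulr_lgt0 _ r1_gt0) mass mulr_gt0.
have w1n : v1 - s != 0 by rewrite gt_eqF.
have mom' : P1 + r1 * (v1 - s) ^+ 2 = P0 + r0 * (v0 - s) ^+ 2.
  have -> : P1 + r1 * (v1 - s) ^+ 2 =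
    (v1 - s) * (r1 * v1) + P1 - s * ((v1 - s) * r1) by ring.
  by rewrite mom mass; ring.
have g10 : g - 1 != 0 by lra.
have gp10 : g + 1 != 0 by lra.
have ener' : g / (g - 1) * (P1 / r1) + (v1 - s) ^+ 2 / 2 =
             g / (g - 1) * (P0 / r0) + (v0 - s) ^+ 2 / 2.
  (* in the frame of the front the energy balance is, up to the momentum
     balance, the mass flux times the balance of the total enthalpy *)
  have r1E : r1 = r0 * (v0 - s) / (v1 - s).
    by apply: (mulIf w1n); rewrite divfK // mulrC mass mulrC.
  apply/eqP; rewrite -subr_eq0; apply/eqP; apply: (mulfI (mulf_neq0 r0n w0n)).
  rewrite mulr0.
  move/eqP: mom'; rewrite -subr_eq0 => /eqP mom'.
  move/eqP: ener; rewrite -subr_eq0 => /eqP ener.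
  apply: etrans (_ : 0 - s * 0 = 0); last by rewrite mulr0 subr0.
  rewrite -{1}ener -mom' r1E.
  by field; rewrite r0n g10 w0n w1n.
have sup : g * P0 / r0 < (v0 - s) ^+ 2.
  by rewrite -c02 ltr_pXn2r ?nnegrE ?ltW //; lra.
have sub : (v1 - s) ^+ 2 < g * P1 / r1.
  by rewrite -c12 ltr_pXn2r ?nnegrE ?ltW //; lra.
have [P01 w02] := shock_relations g1 r0_gt0 r1_gt0 p0 w0
  (etrans (mulrC _ _) (etrans mass (mulrC _ _))) mom' ener' sup sub.
rewrite P01; split.
- rewrite max_l ?divr_ge0 ?subr_ge0 ?ltW //.
  rewrite -{1}(ger0_norm (ltW c0_gt0)) -sqrtr_sqr -sqrtrM ?sqr_ge0 //.
  have -> : c0 ^+ 2 * (1 + (g + 1) / (2 * g) * ((P1 - P0) / P0)) = (v0 - s) ^+ 2.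
    by rewrite c02 w02; field; rewrite r0n gp10 !gt_eqF //; lra.
  by rewrite sqrtr_sqr (ger0_norm (ltW w0)); ring.
- have -> : 2 / ((g + 1) * r0) / (P1 + (g - 1) / (g + 1) * P0) =
      ((v0 - s)^-1 / r0) ^+ 2.
    rewrite exprMn !exprVn w02; field; rewrite r0n gp10 !gt_eqF //.
    by apply: addr_gt0; apply: mulr_gt0 => //; lra.
  rewrite sqrtr_sqr ger0_norm ?divr_ge0 ?invr_ge0 ?ltW //.
  have -> : P1 - P0 = r0 * (v0 - s) * (v0 - v1).
    have -> : P1 = P0 + r0 * (v0 - s) ^+ 2 - (v1 - s) * r1 * (v1 - s).
      by rewrite -mom'; ring.
    by rewrite mass; ring.
  by field; rewrite r0n w0n.
Qed.

(** No mass crosses a front next to the vacuum, so there is no momentum flux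
    that could balance the pressure of the gas. *)
Lemma no_vacuum_shock s um : admissible um ->
  ~ rankine_hugoniot cp cv s um 0.
Proof.
move=> hm RH; have := rankine_hugoniot_mass RH.
rewrite density0 mulr0 => /esym/eqP; rewrite mulf_eq0 (negbTE (density_neq0 hm)).
rewrite orbF => /eqP vs; have [_ + _] := rankine_hugoniotE RH.
rewrite vs mul0r add0r pressure0 addr0 /momentum mxE mulr0 => e.
by have := pressure_gt0 hm; rewrite -e ltxx.
Qed.

(** * Expansions *)

Lemma is_derive_unique (f : R -> R) (x d1 d2 : R) :
  is_derive x 1 f d1 -> is_derive x 1 f d2 -> d1 = d2.
Proof. by case=> _ <- [_ <-]. Qed.

(** In this form an integral of the motion gets its value from the gas in front
    of the fan, although the profile is unconstrained on the ray of the head itself. *)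
Lemma is_derive0_cst (f : R -> R) (a b l : R) :
  (forall x, a < x < b -> is_derive x 1 f 0) ->
  f x @[x --> a^'+] --> l -> forall x, a < x < b -> f x = l.
Proof.
move=> df fl x axb.
have fE y : a < y < x -> f y = f x.
  move=> /andP[ay yx]; case/andP: axb => ax xb.
  have [||z _] := @MVT_segment R f (cst 0) y x (ltW yx).
  - move=> z; rewrite in_itv /= => /andP[yz zx]; apply: df.
    by rewrite (lt_trans ay yz) (lt_trans zx xb).
  - apply: derivable_within_continuous => z; rewrite in_itv /= => /andP[yz zx].
    suff /df[] : a < z < b by [].
    by rewrite (lt_le_trans ay yz) (le_lt_trans zx xb).
  by rewrite /= mul0r => /eqP; rewrite subr_eq0 => /eqP.
apply: (@cvg_unique _ (@Rhausdorff R) (f y @[y --> a^'+])) => //.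
apply: cvg_near_cst; near=> y; apply: fE.
by apply/andP; split; near: y; [exact: nbhs_right_gt|
  apply: nbhs_right_lt; case/andP: axb].
Unshelve. all: by end_near. Qed.

Section StateLimits.
Context (T : Type) (F : set_system T) {FF : Filter F}.
Context (U : T -> 'rV[R]_(n + 2)) (u : 'rV[R]_(n + 2)).
Hypothesis hU : U x @[x --> F] --> u.

Lemma cvg_coord j : U x 0 j @[x --> F] --> u 0 j.
Proof.
exact: (cvg_comp U (fun M : 'rV_(n + 2) => M 0 j) hU
  (@coord_continuous _ _ _ 0 j u)).
Qed.

Lemma cvg_density : density (U x) @[x --> F] --> density u.
Proof.
by apply: cvg_big; [exact: add_continuous|move=> k _; exact: cvg_coord].
Qed.

Lemma cvg_velocity : density u != 0 -> velocity (U x) @[x --> F] --> velocity u.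
Proof.
by move=> r0; apply: cvgM; [exact: cvg_coord|apply: cvgV r0 cvg_density].
Qed.

Lemma cvg_mass_frac k : density u != 0 ->
  mass_frac (U x) k @[x --> F] --> mass_frac u k.
Proof.
by move=> r0; apply: cvgM; [exact: cvg_coord|apply: cvgV r0 cvg_density].
Qed.

(** Along the waves considered here [gamma] is constant; assuming this spares
    the continuity of the quotient of the specific heats. *)
Lemma cvg_pressure (g : R) : density u != 0 -> gamma cp cv u = g ->
  (\forall x \near F, gamma cp cv (U x) = g) ->
  pressure cp cv (U x) @[x --> F] --> pressure cp cv u.
Proof.
move=> r0 gu gU; rewrite /pressure gu.
apply: cvg_trans (_ : (g - 1) * density (U x) * internal_energy (U x)
                        @[x --> F] --> _).
  by apply: near_eq_cvg; near=> x; rewrite (near gU x).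
apply: cvgM; first by apply: cvgM; [exact: cvg_cst|exact: cvg_density].
apply: cvgB; first by apply: cvgM; [exact: cvg_coord|apply: cvgV r0 cvg_density].
apply: cvgM; last exact: cvg_cst.
by rewrite expr2; under eq_fun do rewrite expr2; apply: cvgM; exact: cvg_velocity.
Unshelve. all: by end_near. Qed.

End StateLimits.

(** With [d] for the derivative along a fan, the first [n] equations give
    [c d(pdens) = - pdens dv] for every species with the same factor, so the
    composition is transported unchanged, and the momentum equation gives
    [dp = - c rho dv]. *)
Lemma fan_derivatives (U : R -> 'rV[R]_(n + 2)) (x : R) :
  (\forall z \near x, admissible (U z)) ->
  eig_left cp cv (U x) = x -> self_similar_at cp cv U x ->
  let c := sound_speed cp cv (U x) in let r := density (U x) in
  (forall k, is_derive x 1 (fun z => mass_frac (U z) k) 0) /\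
  exists dr dv dp : R,
    [/\ is_derive x 1 (fun z => density (U z)) dr,
        is_derive x 1 (fun z => velocity (U z)) dv,
        is_derive x 1 (fun z => pressure cp cv (U z)) dp,
        c * dr = - (r * dv) & dp = - (c * r * dv)].
Proof.
move=> adm lam ss c r.
have hx : admissible (U x) := nbhs_singleton adm.
have r0 : r != 0 := density_neq0 hx.
have c0 : c != 0 by rewrite gt_eqF // sound_speed_gt0.
have vE : velocity (U x) - x = c.
  by rewrite -[X in _ - X]lam /eig_left subKr.
have /choice[d dP] : forall k : 'I_n, exists d : R,
    is_derive x 1 (fun z => pdens (U z) k) d /\
    is_derive x 1 (fun z => velocity (U z) * pdens (U z) k) (x * d).
  move=> k; have [d [d1 d2]] := ss (lshift 2 k); exists d; split => //.
  by under eq_fun do rewrite -(flux_pdens cp cv).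
have [dm [dm1 dm2]] := ss (rshift n (0 : 'I_2)).
have drho : is_derive x 1 (fun z => density (U z)) (\sum_k d k).
  have -> : (fun z => density (U z)) = \sum_k (fun z => pdens (U z) k).
    by apply/funext => z; rewrite fct_sumE.
  by apply: is_derive_sum => k; case: (dP k).
have drV := is_deriveV r0 drho.
have dv := is_deriveM dm1 drV.
set dv' := (X in is_derive _ _ _ X) in dv.
have {}dv : is_derive x 1 (fun z => velocity (U z)) dv' by [].
clearbody dv'.
have mk k : c * d k = - (pdens (U x) k * dv').
  have [d1 d2] := dP k.
  have := is_derive_unique d2 (is_deriveM dv d1).
  rewrite /GRing.scale /= -vE => e.
  by rewrite mulrBl e; ring.
have mr : c * \sum_k d k = - (r * dv').
  by rewrite mulr_sumr mulr_suml -sumrN; apply: eq_bigr => k _.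
split.
  move=> k; have [d1 _] := dP k.
  apply: (is_derive_eq (is_deriveM d1 drV)).
  rewrite /GRing.scale /= -/r; apply: (mulfI c0); rewrite mulr0 mulrDr.
  have -> : c * (pdens (U x) k * (- r ^- 2 * \sum_k d k)) =
    - pdens (U x) k * r ^- 2 * (c * \sum_k d k) by ring.
  have -> : c * (r^-1 * d k) = r^-1 * (c * d k) by ring.
  by rewrite mr mk; field.
have dmr : dm = r * dv' + velocity (U x) * \sum_k d k.
  apply: (is_derive_unique dm1).
  apply: (@near_eq_is_derive _ _ _ (fun z => density (U z) * velocity (U z))).
    by near=> z; rewrite -momentumE // density_neq0 //; near: z.
  by apply: (is_derive_eq (is_deriveM drho dv)); rewrite /GRing.scale /= -/r; ring.
exists (\sum_k d k), dv', (x * dm - (velocity (U x) * dm + momentum (U x) * dv')).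
split => //.
  have -> : (fun z => pressure cp cv (U z)) =
      (fun z => flux cp cv (U z) 0 (rshift n (0 : 'I_2)))
      - (fun z => velocity (U z) * momentum (U z)).
    by apply/funext => z; rewrite !fctE flux_momentum addrC addKr.
  exact: is_deriveB dm2 (is_deriveM dv dm1).
rewrite dmr (momentumE r0) -/r.
have -> : x * (r * dv' + velocity (U x) * \sum_k d k) =
    (velocity (U x) - c) * (r * dv' + velocity (U x) * \sum_k d k).
  by rewrite -vE subKr.
transitivity (- (c * r * dv') - velocity (U x) * (c * \sum_k d k + r * dv')).
  by ring.
by rewrite mr addNr mulr0 subr0.
Unshelve. all: by end_near.
Qed.

Section Fan.
Context (U : R -> 'rV[R]_(n + 2)) (a b : R) (um : 'rV[R]_(n + 2)).
Hypotheses (ab : a < b) (hm : admissible um).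
Hypothesis head : U x @[x --> a^'+] --> um.
Hypothesis fan : forall x, a < x < b ->
  [/\ admissible (U x), eig_left cp cv (U x) = x & self_similar_at cp cv U x].

Let g := gamma cp cv um.
Let vm := velocity um.
Let pm := pressure cp cv um.
Let cm := sound_speed cp cv um.

Let g1 : 1 < g. Proof. exact: gamma_gt1. Qed.

Let gp1 : g + 1 != 0.
Proof. by rewrite gt_eqF // addr_gt0 // (lt_trans ltr01). Qed.

Let gm1 : g - 1 != 0. Proof. by rewrite subr_eq0 gt_eqF. Qed.

Let g0 : g != 0. Proof. by rewrite gt_eqF // (lt_trans ltr01). Qed.

Lemma near_fan x : a < x < b -> \forall z \near x, a < z < b.
Proof.
move=> axb; have := @near_in_itvoo R a b x; rewrite in_itv /= => /(_ axb).
by apply: filterS => z; rewrite in_itv.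
Qed.

Lemma near_head : \forall x \near a^'+, a < x < b.
Proof.
near=> x; apply/andP; split; near: x.
- exact: nbhs_right_gt.
- exact: nbhs_right_lt.
Unshelve. all: by end_near. Qed.

Lemma near_tail : \forall x \near b^'-, a < x < b.
Proof.
near=> x; apply/andP; split; near: x.
- exact: nbhs_left_gt.
- exact: nbhs_left_lt.
Unshelve. all: by end_near. Qed.

Lemma fan_admissible x : a < x < b -> admissible (U x).
Proof. by case/fan. Qed.

Lemma fan_near_admissible x : a < x < b -> \forall z \near x, admissible (U z).
Proof. by move=> /near_fan; apply: filterS => z /fan_admissible. Qed.

Lemma fan_sound_speed x : a < x < b ->
  velocity (U x) - x = sound_speed cp cv (U x).
Proof.
by case/fan => _ lam _; rewrite -[X in _ - X]lam /eig_left subKr.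
Qed.

Lemma fan_mass_frac x k : a < x < b -> mass_frac (U x) k = mass_frac um k.
Proof.
move=> axb.
apply: (is_derive0_cst (f := fun z => mass_frac (U z) k) _ _ axb) => [y ayb|].
  have [_ lam ss] := fan ayb.
  by case: (fan_derivatives (fan_near_admissible ayb) lam ss).
by apply: cvg_mass_frac => //; exact: density_neq0.
Qed.

Lemma fan_gamma x : a < x < b -> gamma cp cv (U x) = g.
Proof. by move=> axb; apply: gamma_mass_frac => k; exact: fan_mass_frac. Qed.

Lemma fan_sound_square x : a < x < b ->
  (velocity (U x) - x) * (velocity (U x) - x) * density (U x) =
  g * pressure cp cv (U x).
Proof.
move=> axb; have hx := fan_admissible axb.
rewrite fan_sound_speed // -expr2 sound_speed_sqr // fan_gamma //.
by rewrite divfK // density_neq0.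
Qed.

(** Differentiating [c ^ 2 rho = gamma p] and inserting the laws for [d rho]
    and [dp] gives [2 dc = - (gamma - 1) dv]; as the ray itself moves at the
    speed [v - c], also [dv - dc = 1]. *)
Lemma fan_velocity_derivative x : a < x < b ->
  is_derive x 1 (fun z => velocity (U z)) (2 / (g + 1)) /\
  is_derive x 1 (fun z => pressure cp cv (U z))
    (- ((velocity (U x) - x) * density (U x) * (2 / (g + 1)))).
Proof.
move=> axb; have [hx lam ss] := fan axb.
have [_ [dr [dv [dp [der_r der_v der_p mass mom]]]]] :=
  fan_derivatives (fan_near_admissible axb) lam ss.
have der_c := is_deriveB der_v (is_derive_id x 1).
have der_l := is_deriveM (is_deriveM der_c der_c) der_r.
have der_g := is_deriveM (is_derive_cst g x 1) der_p.
rewrite (fan_sound_speed axb).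
set c := sound_speed _ _ _ in mass mom *.
have c0 : 0 < c := sound_speed_gt0 hx.
have r0 := density_gt0 hx.
have e : 2 * c * (dv - 1) * density (U x) + c ^+ 2 * dr = g * dp.
  have cE z : a < z < b -> (velocity (U z) - z) * (velocity (U z) - z)
      * density (U z) = g * pressure cp cv (U z).
    by move=> azb; rewrite fan_sound_square.
  have eq_near : \forall z \near x, (cst g * (pressure cp cv \o U)) z =
      ((velocity (U z) - z) * (velocity (U z) - z)) * density (U z).
    by near=> z; rewrite !fctE cE //; near: z; exact: near_fan.
  have := is_derive_unique der_l (near_eq_is_derive eq_near der_g).
  rewrite /GRing.scale /= !fctE !(fan_sound_speed axb) -/c => e.
  by move: e; rewrite mulr0 addr0 => <-; ring.
have dvE : dv = 2 / (g + 1).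
  apply: (mulIf gp1); rewrite divfK //.
  have cr0 : c * density (U x) != 0 by rewrite mulf_neq0 ?gt_eqF.
  apply: (mulfI cr0); apply/eqP; rewrite -subr_eq0; apply/eqP.
  transitivity (2 * c * (dv - 1) * density (U x) + c ^+ 2 * dr - g * dp).
    rewrite mom expr2 -[c * c * dr]mulrA mass; ring.
  by rewrite e subrr.
by split; [rewrite -dvE|rewrite -dvE -mom].
Unshelve. all: by end_near. Qed.

Lemma fan_velocity x : a < x < b ->
  velocity (U x) = vm + 2 / (g + 1) * (x - a).
Proof.
move=> axb; have rm := density_neq0 hm; pose k : R := 2 / (g + 1).
have -> : velocity (U x) = velocity (U x) - k * x + k * x by rewrite subrK.
rewrite (is_derive0_cst (f := fun z => velocity (U z) - k * z)
  (l := vm - k * a) _ _ axb) /k; first by ring.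
  move=> y ayb; have [dv _] := fan_velocity_derivative ayb.
  have dk := is_deriveM (is_derive_cst k y 1) (is_derive_id y 1).
  apply: (is_derive_eq (is_deriveB dv dk)).
  by rewrite /GRing.scale /= /cst /k; ring.
apply: cvgB; first exact: cvg_velocity.
by apply: cvgM; [exact: cvg_cst|apply: cvg_at_right_filter; exact: cvg_id].
Qed.

(** The defining relation of the sound speed survives in the limit at either
    end of the fan. The limits [l] of the velocity and [P] of the pressure are
    kept apart from the state [u] because at a vacuum end the velocity of the
    limit state is not the limit of the velocities. *)
Lemma fan_limit (F : set_system R) {FF : ProperFilter F} (t l P : R) u :
  (\forall x \near F, a < x < b) -> x @[x --> F] --> t ->
  U x @[x --> F] --> u -> velocity (U x) @[x --> F] --> l ->
  pressure cp cv (U x) @[x --> F] --> P ->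
  t <= l /\ (l - t) ^+ 2 * density u = g * P.
Proof.
move=> inF Ft Uu vl pP; split.
  rewrite -subr_ge0; apply: (cvgr_to_ge (cvgB vl Ft)).
  near=> x; have axb : a < x < b by near: x.
  by rewrite !fctE (fan_sound_speed axb) sqrtr_ge0.
have l1 : (velocity (U x) - x) ^+ 2 * density (U x) @[x --> F]
    --> (l - t) ^+ 2 * density u.
  apply: cvgM; last exact: cvg_density.
  by rewrite expr2; under eq_fun do rewrite expr2; apply: cvgM; exact: cvgB.
have l2 : (velocity (U x) - x) ^+ 2 * density (U x) @[x --> F] --> g * P.
  apply: cvg_trans (_ : g * pressure cp cv (U x) @[x --> F] --> _).
    apply: near_eq_cvg; near=> x.
    by rewrite expr2 fan_sound_square //; near: x.
  by apply: cvgM pP; exact: cvg_cst.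
exact: (cvg_unique (@Rhausdorff R) l1 l2).
Unshelve. all: by end_near. Qed.

Lemma fan_head_pressure : pressure cp cv (U x) @[x --> a^'+] --> pm.
Proof.
apply: (cvg_pressure (g := g) head (density_neq0 hm) erefl).
by apply: filterS near_head => x; exact: fan_gamma.
Qed.

Lemma fan_head : a = eig_left cp cv um.
Proof.
have rm := density_neq0 hm.
have [av /(canRL (mulfK rm)) sq] := fan_limit near_head
  (cvg_at_right_filter (@cvg_id _ (nbhs a))) head (cvg_velocity head rm)
  fan_head_pressure.
rewrite /eig_left; suff -> : sound_speed cp cv um = vm - a by rewrite subKr.
apply/eqP; rewrite -(eqrXn2 (n := 2)) ?subr_ge0 ?sqrtr_ge0 //.
by rewrite (sound_speed_sqr hm) sq.
Qed.

(** Along the fan [dp / p = - gamma dv / c] and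
    [dc / c = - (gamma - 1) / 2 dv / c], so this is the integral
    [p / c ^ (2 gamma / (gamma - 1)) = const]. *)
Lemma fan_isentropic x : a < x < b ->
  ln (pressure cp cv (U x)) =
  ln pm + (2 * g) / (g - 1) * (ln (velocity (U x) - x) - ln cm).
Proof.
move=> axb; have rm := density_neq0 hm; pose k := 2 * g / (g - 1).
have cE : vm - a = cm by rewrite fan_head subKr.
rewrite -/k mulrBr addrCA [RHS]addrC; apply/eqP; rewrite -subr_eq; apply/eqP.
apply: (is_derive0_cst (f := fun z => ln (pressure cp cv (U z))
   - k * ln (velocity (U z) - z)) _ _ axb).
  move=> y ayb; have [dv dp] := fan_velocity_derivative ayb.
  have hy := fan_admissible ayb.
  have py := pressure_gt0 hy.
  have cy : 0 < velocity (U y) - y.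
    by rewrite fan_sound_speed // sound_speed_gt0.
  have dc := is_deriveB dv (is_derive_id y 1).
  have d1 := @is_derive1_comp _ (@ln R) (fun z => pressure cp cv (U z)) _ _ _
    (is_derive1_ln py) dp.
  have d2 := @is_derive1_comp _ (@ln R) (fun z => velocity (U z) - z) _ _ _
     (is_derive1_ln cy) dc.
  apply: (is_derive_eq (is_deriveB d1 (is_deriveM (is_derive_cst k y 1) d2))).
  rewrite /GRing.scale /= /cst mulr0 addr0 /k.
  have := fan_sound_square ayb; have := density_neq0 hy.
  move: (velocity (U y) - y) (pressure cp cv (U y)) (density (U y)) cy py.
  move=> c p r /lt0r_neq0 c0 _ r0 e.
  have -> : p = c * c * r / g by rewrite e mulrC mulKf.
  by field; rewrite g0 gm1 gp1 r0 c0.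
rewrite -cE; apply: cvgB.
  apply: (cvg_comp _ _ fan_head_pressure); apply: continuous_ln.
  exact: pressure_gt0.
apply: cvgM; first exact: cvg_cst.
have cl : velocity (U z) - z @[z --> a^'+] --> vm - a.
  by apply: cvgB; [exact: cvg_velocity|exact: cvg_at_right_filter cvg_id].
apply: (cvg_comp _ _ cl).
by apply: continuous_ln; rewrite cE sound_speed_gt0.
Qed.

Section FanTail.
Context (up : 'rV[R]_(n + 2)).
Hypothesis tail : U x @[x --> b^'-] --> up.
Hypothesis hp : admissible up \/ up = 0.

Lemma fan_tail_pressure :
  pressure cp cv (U x) @[x --> b^'-] --> pressure cp cv up.
Proof.
case: hp => [hup|up0].
  have rp := density_neq0 hup.
  apply: (cvg_pressure (g := g) tail rp); last first.
    by apply: filterS near_tail => x; exact: fan_gamma.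
  apply: gamma_mass_frac => k.
  apply: (cvg_unique (@Rhausdorff R) (cvg_mass_frac (k := k) tail rp)).
  apply: cvg_near_cst; near=> x; apply: fan_mass_frac.
  by near: x; exact: near_tail.
(* at the vacuum the kinetic energy m ^ 2 / (2 rho) has no obvious limit, but
   it is nonnegative, so the pressure is at most (gamma - 1) E *)
rewrite up0 pressure0.
apply: (squeeze_cvgr (f := cst 0) (h := fun x => (g - 1) * energy (U x))).
- near=> x; have axb : a < x < b by near: x; exact: near_tail.
  have hx := fan_admissible axb; rewrite /= ltW ?pressure_gt0 //=.
  have gx : gamma cp cv (U x) != 1 by rewrite gt_eqF // gamma_gt1.
  rewrite (energyE (density_neq0 hx) gx) fan_gamma // mulrDr mulrCA divff // mulr1.
  rewrite lerDl mulr_ge0 ?subr_ge0 ?(ltW g1) // divr_ge0 // mulr_ge0 ?sqr_ge0 //.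
  by rewrite ltW // density_gt0.
- exact: cvg_cst.
- rewrite -[X in _ --> X](mulr0 (g - 1)); apply: cvgM; first exact: cvg_cst.
  have := cvg_coord (j := rshift n (1 : 'I_2)) tail.
  by rewrite up0 mxE.
Unshelve. all: by end_near. Qed.

Lemma fan_tail_velocity :
  velocity (U x) @[x --> b^'-] --> vm + 2 / (g + 1) * (b - a).
Proof.
apply: cvg_trans (_ : vm + 2 / (g + 1) * (x - a) @[x --> b^'-] --> _).
  apply: near_eq_cvg; near=> x; rewrite fan_velocity //.
  by near: x; exact: near_tail.
apply: cvgD; first exact: cvg_cst.
apply: cvgM; first exact: cvg_cst.
apply: cvgB; last exact: cvg_cst.
exact: cvg_at_left_filter cvg_id.
Unshelve. all: by end_near. Qed.

(** Either the fan stops at a positive sound speed, where the isentropic law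
    can be continued, or the sound speed, hence also the pressure, vanish. *)
Lemma fan_tail_isentropic :
  let cb := vm + 2 / (g + 1) * (b - a) - b in
  pressure cp cv up <= pm /\
  (pressure cp cv up / pm) `^ ((g - 1) / (2 * g)) = cb / cm.
Proof.
move=> cb; have cm0 : 0 < cm := sound_speed_gt0 hm.
have pm0 : 0 < pm := pressure_gt0 hm.
have gg1 : 0 < g - 1 by rewrite subr_gt0.
have gg0 : 0 < g by rewrite (lt_trans ltr01).
have [] := fan_limit near_tail (cvg_at_left_filter (@cvg_id _ (nbhs b))) tail
  fan_tail_velocity fan_tail_pressure.
rewrite -subr_ge0 -/cb le_eqVlt => /orP[/eqP cb0|cb0] sq.
  have -> : pressure cp cv up = 0.
    by apply: (mulfI g0); rewrite -sq -cb0 expr0n mul0r mulr0.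
  rewrite (ltW pm0) !mul0r -cb0 mul0r powR0 //.
  by rewrite mulf_neq0 // invr_neq0 // mulf_neq0 // pnatr_eq0.
set L := ln pm + (2 * g) / (g - 1) * (ln cb - ln cm).
have pE : pressure cp cv up = expR L.
  apply: (cvg_unique (@Rhausdorff R) fan_tail_pressure).
  apply: cvg_trans (_ : expR (ln pm + (2 * g) / (g - 1) *
    (ln (velocity (U x) - x) - ln cm)) @[x --> b^'-] --> _).
    apply: near_eq_cvg; near=> x.
    have axb : a < x < b by near: x; exact: near_tail.
    rewrite -fan_isentropic // lnK // posrE.
    exact: pressure_gt0 (fan_admissible axb).
  have cl : velocity (U x) - x @[x --> b^'-] --> cb.
    apply: cvgB; first exact: fan_tail_velocity.
    exact: cvg_at_left_filter cvg_id.
  have ll : ln (velocity (U x) - x) @[x --> b^'-] --> ln cb.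
    by apply: (cvg_comp _ _ cl); exact: continuous_ln.
  have le : ln pm + (2 * g) / (g - 1) * (ln (velocity (U x) - x) - ln cm)
      @[x --> b^'-] --> L.
    apply: cvgD; first exact: cvg_cst.
    apply: cvgM; first exact: cvg_cst.
    by apply: cvgB => //; exact: cvg_cst.
  by apply: (cvg_comp _ _ le); exact: continuous_expR.
have cb_cm : cb < cm.
  have -> : cm = vm - a by rewrite fan_head subKr.
  rewrite -subr_gt0.
  have -> : vm - a - cb = (g - 1) / (g + 1) * (b - a) by rewrite /cb; field.
  by rewrite mulr_gt0 ?subr_gt0 // divr_gt0 // addr_gt0.
split.
  rewrite pE -[leRHS]lnK ?posrE // ler_expR /L gerDl mulr_ge0_le0 //.
    by rewrite ltW // divr_gt0 // mulr_gt0.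
  by rewrite subr_le0 ltW // ltr_ln ?posrE.
have pp0 : 0 < pressure cp cv up by rewrite pE expR_gt0.
apply: ln_inj; rewrite ?posrE ?powR_gt0 ?divr_gt0 //.
rewrite ln_powR !ln_div ?posrE // pE expRK /L.
by field; rewrite g0 gm1.
Unshelve. all: by end_near. Qed.

End FanTail.

End Fan.

(** * One wave *)

(** A wave that does not compress the gas has its leading edge at the
    characteristic speed of the gas in front of it. *)
Lemma lambdaL_rarefaction u p : admissible u -> p <= pressure cp cv u ->
  lambdaL cp cv u p = eig_left cp cv u.
Proof.
move=> hu pP; rewrite /lambdaL /speed_factor max_r; last first.
  by rewrite pmulr_lle0 ?subr_le0 // invr_gt0 pressure_gt0.
by rewrite mulr0 addr0 sqrtr1 mulr1.
Qed.

Lemma f_wave_pressure u : admissible u ->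
  f_wave cp cv u (pressure cp cv u) = 0.
Proof.
move=> hu; rewrite /f_wave ltxx divff ?gt_eqF ?pressure_gt0 //.
by rewrite powR1 subrr mulr0.
Qed.

(** The second and the third conclusion locate the contact: at the velocity of
    the state behind the wave, or, if this state is the vacuum, at the tail of
    the fan. *)
Lemma left_wave (U : R -> 'rV[R]_(n + 2)) w (a b : R) um up :
  admissible um -> admissible up \/ up = 0 ->
  is_wave cp cv (eig_left cp cv) U w a b um up ->
  [/\ a = lambdaL cp cv um (pressure cp cv up),
      admissible up ->
        velocity up = velocity um - f_wave cp cv um (pressure cp cv up)
    & up = 0 -> b = velocity um - f_wave cp cv um (pressure cp cv up)].
Proof.
move=> hm hp; case: w => /=.
- case=> _ RH lax; case: hp => [hup|up0].
    have [-> ->] := left_shock hm hup RH lax; split=> // up0.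
    by have := density_gt0 hup; rewrite up0 density0 ltxx.
  by rewrite up0 in RH; case: (no_vacuum_shock hm RH).
- case=> ab head tail fan.
  have [Pp pw] := fan_tail_isentropic ab hm head fan tail hp.
  have cm0 := sound_speed_gt0 hm; have g1 := gamma_gt1 hm.
  have aE := fan_head ab hm head fan.
  have fE : velocity um - f_wave cp cv um (pressure cp cv up) =
      velocity um + 2 / (gamma cp cv um + 1) * (b - a).
    rewrite /f_wave ltNge Pp /= pw -/(sound_speed cp cv um).
    have -> : velocity um = sound_speed cp cv um + a.
      by rewrite aE /eig_left subrKC.
    have [gm1 gp1] : gamma cp cv um - 1 != 0 /\ gamma cp cv um + 1 != 0.
      by split; rewrite gt_eqF //; lra.
    by field; rewrite ?gm1 ?gp1 ?(gt_eqF cm0).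
  split=> [|hup|up0].
  + by rewrite lambdaL_rarefaction.
  + rewrite fE; apply: (cvg_unique (@Rhausdorff R)
      (cvg_velocity tail (density_neq0 hup))).
    exact: fan_tail_velocity.
  + rewrite fE; move: pw; rewrite up0 pressure0 mul0r powR0; last first.
      by rewrite gt_eqF // divr_gt0 //; lra.
    move=> /esym/eqP; rewrite mulf_eq0 invr_eq0 (gt_eqF cm0) orbF subr_eq0.
    by move=> /eqP.
- case=> _ <- ->; rewrite f_wave_pressure // subr0 lambdaL_rarefaction //.
  split=> // um0; have := density_gt0 hm.
  by rewrite um0 density0 ltxx.
Qed.

End AdmissibleStates.

(** The closure in the definition of the speeds of an expansion is what makes
    both edges of the fan belong to it. *)
Lemma wave_speeds_bounds (R : realType) (n : nat) (cp cv : 'I_n -> R) lam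
    (U : R -> 'rV[R]_(n + 2)) w (a b : R) um up :
  is_wave cp cv lam U w a b um up ->
  [/\ wave_speeds lam U w a b um a, wave_speeds lam U w a b um b
    & forall s, wave_speeds lam U w a b um s -> a <= s <= b].
Proof.
case: w => /=.
- by case=> <- _ _; split=> // s ->; rewrite lexx.
- case=> ab _ _ fan.
  have -> : [set lam (U x) | x in `]a, b[%classic] = `]a, b[%classic.
    apply/seteqP; split=> [_ [x + <-]|x]; rewrite /= in_itv /= => xab.
      by have [_ -> _] := fan x xab; rewrite in_itv.
    by exists x; [rewrite /= in_itv|have [] := fan x xab].
  split.
  + move=> B Ba; have Bx : \forall x \near a^'+, B x.
      exact: (cvg_at_right_filter (@cvg_id _ (nbhs a)) Ba).
    have [x [xab xB]] := filter_ex (filterI (near_head ab) Bx).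
    by exists x; split; rewrite //= in_itv.
  + move=> B Bb; have Bx : \forall x \near b^'-, B x.
      exact: (cvg_at_left_filter (@cvg_id _ (nbhs b)) Bb).
    have [x [xab xB]] := filter_ex (filterI (near_tail ab) Bx).
    by exists x; split; rewrite //= in_itv.
  + by move=> s /itv_closure; rewrite /= in_itv.
- by case=> <- _ ->; split=> // s ->; rewrite lexx.
Qed.

(** * Reflection of space *)

Section Mirror.
Context (R : realType) (n : nat) (cp cv : 'I_n -> R).
Implicit Types (u um up : 'rV[R]_(n + 2)) (s p : R).

Definition mirror_sign (i : 'I_(n + 2)) : R :=
  if i == rshift n (0 : 'I_2) then -1 else 1.

(** The state seen by an observer facing the opposite direction. *)
Definition mirror u : 'rV[R]_(n + 2) := \row_i (mirror_sign i * u 0 i).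

Lemma mirror_sign_pdens (k : 'I_n) : mirror_sign (lshift 2 k) = 1.
Proof. by rewrite /mirror_sign eq_lrshift. Qed.

Lemma mirror_sign_momentum : mirror_sign (rshift n (0 : 'I_2)) = -1.
Proof. by rewrite /mirror_sign eqxx. Qed.

Lemma mirror_sign_energy : mirror_sign (rshift n (1 : 'I_2)) = 1.
Proof. by rewrite /mirror_sign eq_rshift. Qed.

Lemma mirror0 : mirror 0 = 0.
Proof. by apply/rowP => i; rewrite !mxE mulr0. Qed.

Lemma pdens_mirror u k : pdens (mirror u) k = pdens u k.
Proof. by rewrite /pdens mxE mirror_sign_pdens mul1r. Qed.

Lemma momentum_mirror u : momentum (mirror u) = - momentum u.
Proof. by rewrite /momentum mxE mirror_sign_momentum mulN1r. Qed.

Lemma energy_mirror u : energy (mirror u) = energy u.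
Proof. by rewrite /energy mxE mirror_sign_energy mul1r. Qed.

Lemma density_mirror u : density (mirror u) = density u.
Proof. by apply: eq_bigr => k _; rewrite pdens_mirror. Qed.

Lemma velocity_mirror u : velocity (mirror u) = - velocity u.
Proof. by rewrite /velocity momentum_mirror density_mirror mulNr. Qed.

Lemma internal_energy_mirror u : internal_energy (mirror u) = internal_energy u.
Proof.
by rewrite /internal_energy energy_mirror density_mirror velocity_mirror sqrrN.
Qed.

Lemma gamma_mirror u : gamma cp cv (mirror u) = gamma cp cv u.
Proof.
by apply: gamma_mass_frac => k; rewrite /mass_frac pdens_mirror density_mirror.
Qed.

Lemma pressure_mirror u : pressure cp cv (mirror u) = pressure cp cv u.
Proof.
by rewrite /pressure gamma_mirror density_mirror internal_energy_mirror.
Qed.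

Lemma sound_speed_mirror u : sound_speed cp cv (mirror u) = sound_speed cp cv u.
Proof.
by rewrite /sound_speed gamma_mirror pressure_mirror density_mirror.
Qed.

Lemma admissible_mirror u : admissible u -> admissible (mirror u).
Proof.
case=> pk r e; split; last 2 first.
- by rewrite density_mirror.
- by rewrite internal_energy_mirror.
- by move=> k; rewrite pdens_mirror.
Qed.

Lemma eig_left_mirror u : eig_left cp cv (mirror u) = - eig_right cp cv u.
Proof.
by rewrite /eig_left /eig_right velocity_mirror sound_speed_mirror opprD.
Qed.

Lemma f_wave_mirror u p : f_wave cp cv (mirror u) p = f_wave cp cv u p.
Proof. by rewrite /f_wave gamma_mirror pressure_mirror density_mirror. Qed.

Lemma lambdaL_mirror u p : lambdaL cp cv (mirror u) p = - lambdaR cp cv u p.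
Proof.
rewrite /lambdaL /lambdaR /speed_factor velocity_mirror sound_speed_mirror.
by rewrite gamma_mirror pressure_mirror opprD.
Qed.

(** The sign in front compensates the reversal of the space derivative. *)
Lemma flux_mirror u i :
  flux cp cv (mirror u) 0 i = - (mirror_sign i * flux cp cv u 0 i).
Proof.
case: (split_ordP i) => [k|j] ->.
  by rewrite mirror_sign_pdens !flux_pdens velocity_mirror pdens_mirror; ring.
have [->|->] : j = 0 \/ j = 1.
  by case: j => [[|[|j]] hj]; [left; exact: val_inj|right; exact: val_inj|].
- rewrite mirror_sign_momentum !flux_momentum velocity_mirror momentum_mirror.
  by rewrite pressure_mirror; ring.
- rewrite mirror_sign_energy !flux_energy velocity_mirror energy_mirror.
  by rewrite pressure_mirror; ring.
Qed.

Lemma rankine_hugoniot_mirror s um up : rankine_hugoniot cp cv s um up ->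
  rankine_hugoniot cp cv (- s) (mirror up) (mirror um).
Proof.
move=> /rowP h; apply/rowP => i; rewrite [LHS]mxE [X in _ + X]mxE !flux_mirror.
have := h i; rewrite [LHS]mxE [X in _ + X = _]mxE => e.
have -> : - (mirror_sign i * flux cp cv um 0 i)
    - - (mirror_sign i * flux cp cv up 0 i) =
  mirror_sign i * (flux cp cv up 0 i - flux cp cv um 0 i) by ring.
by rewrite e !mxE; ring.
Qed.

Lemma self_similar_at_mirror (U : R -> 'rV[R]_(n + 2)) (x : R) :
  self_similar_at cp cv U (- x) ->
  self_similar_at cp cv (fun z => mirror (U (- z))) x.
Proof.
move=> h i; have [d [d1 d2]] := h i; exists (- (mirror_sign i * d)).
have dN (f : R -> R) (l : R) : is_derive (- x) 1 f l ->
    is_derive x 1 (fun z => mirror_sign i * f (- z)) (- (mirror_sign i * l)).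
  move=> df; have dc := @is_derive1_comp _ f -%R x _ _ df (is_deriveNid x 1).
  apply: (is_derive_eq (is_deriveM (is_derive_cst (mirror_sign i) x 1) dc)).
  by rewrite /GRing.scale /= /cst; ring.
split.
  have := dN _ _ d1; congr is_derive.
  by apply/funext => z; rewrite mxE.
have := is_deriveN (dN _ _ d2).
have -> : - - (mirror_sign i * (- x * d)) = x * - (mirror_sign i * d) by ring.
by congr is_derive; apply/funext => z; rewrite flux_mirror.
Qed.

Lemma cvg_mirror (T : Type) (F : set_system T) {FF : Filter F}
    (U : T -> 'rV[R]_(n + 2)) u :
  U x @[x --> F] --> u -> mirror (U x) @[x --> F] --> mirror u.
Proof.
move=> Uu A [P nP sP]; suff /Uu : nbhs u (mirror @^-1` A) by [].
exists (fun i j => [set y | P i j (mirror_sign j * y)]) => [i j|M hM].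
  have := nP i j; rewrite mxE (ord1 i).
  have c : mirror_sign j * y @[y --> u 0 j] --> mirror_sign j * u 0 j.
    by apply: cvgM; [exact: cvg_cst|exact: cvg_id].
  exact: c.
by apply: sP => i j; rewrite mxE -(ord1 i); exact: hM.
Qed.

(** Reflection turns a right wave into a left wave, so only left waves have to
    be analysed. *)
Lemma is_wave_mirror (U : R -> 'rV[R]_(n + 2)) w (a b : R) um up :
  is_wave cp cv (eig_right cp cv) U w a b um up ->
  is_wave cp cv (eig_left cp cv) (fun z => mirror (U (- z))) w (- b) (- a)
    (mirror up) (mirror um).
Proof.
case: w => /=.
- case=> <- RH /andP[l1 l2]; split=> //; first exact: rankine_hugoniot_mirror.
  by rewrite !eig_left_mirror !ltrN2 l2.
- case=> ab head tail fan; split.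
  + by rewrite ltrN2.
  + by apply: (@cvg_mirror _ _ _ (fun z => U (- z)));
      exact: (cvg_at_leftNP U b up).1 tail.
  + by apply: (@cvg_mirror _ _ _ (fun z => U (- z)));
      exact: (cvg_at_rightNP U a um).1 head.
  + move=> x /andP[bx xa].
    have [|adm lam ss] := fan (- x); first by rewrite ltrNr xa ltrNl bx.
    split; first exact: admissible_mirror.
      by rewrite eig_left_mirror lam opprK.
    exact: self_similar_at_mirror.
- by case=> <- <- ->; rewrite eig_left_mirror.
Qed.

Lemma right_wave (hc : forall k : 'I_n, 0 < cv k < cp k)
    (U : R -> 'rV[R]_(n + 2)) w (a b : R) um up :
  admissible up -> admissible um \/ um = 0 ->
  is_wave cp cv (eig_right cp cv) U w a b um up ->
  [/\ b = lambdaR cp cv up (pressure cp cv um),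
      admissible um ->
        velocity um = velocity up + f_wave cp cv up (pressure cp cv um)
    & um = 0 -> a = velocity up + f_wave cp cv up (pressure cp cv um)].
Proof.
move=> hp hm /is_wave_mirror wv.
have hm' : admissible (mirror um) \/ mirror um = 0.
  by case: hm => [/admissible_mirror|->]; [left|right; exact: mirror0].
have := left_wave hc (admissible_mirror hp) hm' wv.
rewrite lambdaL_mirror f_wave_mirror pressure_mirror !velocity_mirror -!opprD.
case=> /oppr_inj e1 e2 e3; split => //.
- by move=> /admissible_mirror/e2/oppr_inj.
- by move=> um0; move: e3; rewrite um0 mirror0 => /(_ erefl)/oppr_inj.
Qed.

End Mirror.

(** * The Riemann problem *)

Lemma contact_pressure (R : realType) (n : nat) (cp cv : 'I_n -> R) (s : R)
    (um up : 'rV[R]_(n + 2)) :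
  is_contact cp cv s um up -> pressure cp cv um = pressure cp cv up.
Proof.
case=> vm vp /rankine_hugoniotE[_ + _].
by rewrite vm vp subrr !mul0r !add0r.
Qed.

Lemma phi_lt (R : realType) (n : nat) (cp cv : 'I_n -> R)
    (hc : forall k : 'I_n, 0 < cv k < cp k) (uL uR : 'rV[R]_(n + 2)) (p q : R) :
  admissible uL -> admissible uR -> 0 <= p -> p < q ->
  phi cp cv uL uR p < phi cp cv uL uR q.
Proof.
move=> hL hR p0 pq; rewrite /phi !ltrD2r.
by apply: ltrD; exact: f_wave_lt.
Qed.

Theorem proposition3p1 (R : realType) (n : nat) (hn : (2 <= n)%N)
  (cp cv : 'I_n -> R) (hc : forall k : 'I_n, 0 < cv k < cp k)
  (uL uR : 'rV[R]_(n + 2)) (hL : admissible uL) (hR : admissible uR)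
  (W : riemann_pattern R n) (hW : riemann_solution cp cv uL uR W)
  (pstar : R) (hpstar : 0 <= pstar) (hroot : phi cp cv uL uR pstar = 0) :
  is_max_wave_speed cp cv uL W
    (Num.max `|lambdaL cp cv uL pstar| `|lambdaR cp cv uR pstar|).
Proof.
case: hW => -[oL osL osR oR] _ wL wR mid.
have sL : admissible (starL W) \/ starL W = 0.
  by case: mid => [[]|[]]; [left|right].
have sR : admissible (starR W) \/ starR W = 0.
  by case: mid => [[]|[]]; [left|right].
have [aE vL bE] := left_wave hc hL sL wL.
have [bE' vR aE'] := right_wave hc hR sR wR.
(* the velocity relations of the two waves meet at the contact, or at the ray
   where both fans reach the vacuum *)
have [p_eq p_ge0 p_root] :
  [/\ pressure cp cv (starL W) = pressure cp cv (starR W),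
    0 <= pressure cp cv (starR W)
  & phi cp cv uL uR (pressure cp cv (starR W)) = 0].
  case: mid => [[aL' aR' ct]|[sL0 sR0 e1 e2]].
    have pe := contact_pressure ct; split=> //; first exact/ltW/pressure_gt0.
    case: ct => vL' vR' _; have := vL aL'; have := vR aR'.
    by rewrite vL' vR' pe /phi; lra.
  split; rewrite ?sL0 ?sR0 ?pressure0 //.
  have := bE sL0; have := aE' sR0.
  by rewrite sL0 sR0 pressure0 e1 -e2 /phi; lra.
have pE : pressure cp cv (starR W) = pstar.
  apply/eqP; rewrite eq_le !leNgt; apply/andP; split; apply/negP => lt.
    by have := phi_lt hc hL hR hpstar lt; rewrite p_root hroot ltxx.
  by have := phi_lt hc hL hR p_ge0 lt; rewrite p_root hroot ltxx.
rewrite -pE -bE' -{1}p_eq -aE.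
have [La Lb Lab] := wave_speeds_bounds wL.
have [Ra Rb Rab] := wave_speeds_bounds wR.
split.
  have [|] := leP `|aL W| `|bR W| => _.
    by exists (bR W) => //; right.
  by exists (aL W) => //; left; left.
suff bound s : aL W <= s <= bR W -> `|s| <= Num.max `|aL W| `|bR W|.
  move=> s [[/Lab h|->]|/Rab h]; apply: bound.
  - case/andP: h => -> h.
    by rewrite (le_trans h) // (le_trans osL) // (le_trans osR).
  - by rewrite (le_trans oL) // (le_trans osR).
  - case/andP: h => h ->; rewrite andbT.
    by rewrite (le_trans _ h) // (le_trans oL) // (le_trans osL).
move=> /andP[as_ sb]; rewrite le_max.
have [s0|s0] := lerP 0 s.
  by apply/orP; right; rewrite !ger0_norm // (le_trans s0 sb).
by apply/orP; left; rewrite !ltr0_norm ?lerN2 // (le_lt_trans as_).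
Qed.
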